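(* Let $m$ be a positive integer, let $r\ge0$, and let $\lambda$ be a nonzero real number. Then for all integers $n,j\ge0$, $$W^{(r)}_{m,\lambda}(n,j)=\sum_{k=j}^n\sum_{l=j}^k\binom{n}{k}\binom{k}{l}(r-1)_{n-k,\lambda}\,(1)_{k-l,\lambda}\,m^{l-j}\,S_{2,\frac{\lambda}{m}}(l,j).$$
   Context: For real $x$ and nonzero real $\mu$, $(x)_{0,\mu}=1$, $(x)_{n,\mu}=x(x-\mu)\cdots(x-(n-1)\mu)$ for $n\ge1$; $(x)_0=1$, $(x)_k=x(x-1)\cdots(x-k+1)$. The degenerate Stirling numbers of the second kind $S_{2,\mu}(n,k)$ are defined by $(x)_{n,\mu}=\sum_{k=0}^nS_{2,\mu}(n,k)(x)_k$ (and are $0$ for $k>n$). The degenerate $r$-Whitney numbers of the second kind $W^{(r)}_{m,\lambda}(n,k)$ are defined by the polynomial identity $(mx+r)_{n,\lambda}=\sum_{k=0}^nW^{(r)}_{m,\lambda}(n,k)m^k(x)_k$ (and are $0$ for $k>n$). *)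

(* Defs.v *)
From mathcomp Require Import all_boot all_order all_algebra.
From mathcomp Require Import reals.

Set Implicit Arguments.
Unset Strict Implicit.
Unset Printing Implicit Defensive.

Import Order.TTheory GRing.Theory Num.Theory.
Local Open Scope ring_scope.

(** (x)_{n,mu} = x (x - mu) ... (x - (n - 1) mu). *)
Definition dfall (R : realType) (x mu : R) (n : nat) : R :=
  \prod_(i < n) (x - i%:R * mu).

(** (x)_k = x (x - 1) ... (x - k + 1). *)
Definition rfall (R : realType) (x : R) (k : nat) : R :=
  \prod_(i < k) (x - i%:R).

Definition degenerate_stirling2_spec (R : realType) (mu : R)
    (S : nat -> nat -> R) : Prop :=
  (forall (n : nat) (x : R),
     dfall x mu n = \sum_(k < n.+1) S n k * rfall x k) /\
  (forall n k : nat, (n < k)%N -> S n k = 0).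

Definition degenerate_whitney2_spec (R : realType) (m : nat) (r lambda : R)
    (W : nat -> nat -> R) : Prop :=
  (forall (n : nat) (x : R),
     dfall (m%:R * x + r) lambda n
     = \sum_(k < n.+1) W n k * m%:R ^+ k * rfall x k) /\
  (forall n k : nat, (n < k)%N -> W n k = 0).

Lemma degenerate_whitney2_ex (R : realType) (m : nat) (r lambda : R) :
  {W : nat -> nat -> R | degenerate_whitney2_spec m r lambda W}.
Proof.
pose step (n : nat) (w : nat -> R) (k : nat) :=
  (if k is k'.+1 then w k' else 0) + (m%:R * k%:R + r - n%:R * lambda) * w k.
pose W := fix W n : nat -> R :=
  if n is n'.+1 then step n' (W n') else fun k => (k == 0)%N%:R.
have W0 n k : (n < k)%N -> W n k = 0.
  elim: n k => [|n IH] [|k] //= ltnk.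
  by rewrite /step IH // IH ?mulr0 ?addr0 // ltnW.
exists W; split=> // n x; elim: n => [|n IH].
  by rewrite /dfall big_ord0 big_ord1 /= /rfall big_ord0 !mulr1.
rewrite /dfall big_ord_recr /= -/(dfall _ _ _) IH.
rewrite [RHS](eq_bigr (fun k : 'I_n.+2 =>
    (if (k : nat) is k'.+1 then W n k' else 0) * m%:R ^+ k * rfall x k
    + (m%:R * k%:R + r - n%:R * lambda) * W n k * m%:R ^+ k * rfall x k));
  last by move=> k _; rewrite /step -!mulrDl.
rewrite big_split /= [X in _ = X + _]big_ord_recl /= !mul0r add0r.
rewrite [X in _ = _ + X]big_ord_recr /= (W0 n n.+1) // mulr0 !mul0r addr0.
rewrite -big_split mulr_suml; apply: eq_bigr => k _ /=.
rewrite /bump /= add1n [rfall x k.+1]/rfall big_ord_recr /= -/(rfall x k) exprSr.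
have -> : m%:R * x + r - n%:R * lambda
    = m%:R * (x - k%:R) + (m%:R * k%:R + r - n%:R * lambda).
  by rewrite mulrBr -[in RHS]addrA !addrA subrK.
rewrite mulrDr; congr (_ + _); last by rewrite mulrC !mulrA.
by rewrite -!mulrA; congr (_ * (_ * _)); rewrite mulrCA.
Qed.

Lemma degenerate_stirling2_ex (R : realType) (mu : R) :
  {S : nat -> nat -> R | degenerate_stirling2_spec mu S}.
Proof.
have [W [Wsum W0]] := degenerate_whitney2_ex 1 0 mu.
exists W; split=> // n x; rewrite -[x in LHS]mul1r -[_ * x]addr0 Wsum.
by apply: eq_bigr => k _; rewrite expr1n mulr1.
Qed.

(** S_{2,mu}(n,k). *)
Definition degenerate_stirling2 (R : realType) (mu : R) : nat -> nat -> R :=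
  sval (degenerate_stirling2_ex mu).

(** W^{(r)}_{m,lambda}(n,k).  For m = 0 the specification has several
    solutions and this picks an arbitrary one. *)
Definition degenerate_whitney2 (R : realType) (m : nat) (r lambda : R) :
    nat -> nat -> R :=
  sval (degenerate_whitney2_ex m r lambda).

Lemma degenerate_stirling2P (R : realType) (mu : R) :
  degenerate_stirling2_spec mu (degenerate_stirling2 mu).
Proof. exact: svalP. Qed.

Lemma degenerate_whitney2P (R : realType) (m : nat) (r lambda : R) :
  degenerate_whitney2_spec m r lambda (degenerate_whitney2 m r lambda).
Proof. exact: svalP. Qed.

Lemma rfall_gt (R : realType) (i k : nat) :
  (i < k)%N -> rfall (i%:R : R) k = 0.
Proof.
by move=> ltik; rewrite /rfall (bigD1 (Ordinal ltik)) //= subrr mul0r.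
Qed.

Lemma rfall_neq0 (R : realType) (i : nat) : rfall (i%:R : R) i != 0.
Proof.
apply/prodf_neq0 => j _; rewrite subr_eq0 eqr_nat neq_ltn.
by rewrite ltn_ord orbT.
Qed.

Lemma rfall_free (R : realType) (N : nat) (a b : nat -> R) :
  (forall x : R, \sum_(k < N) a k * rfall x k = \sum_(k < N) b k * rfall x k) ->
  forall k : nat, (k < N)%N -> a k = b k.
Proof.
move=> eqab; elim/ltn_ind => i IH ltiN.
have := eqab i%:R; rewrite (bigD1 (Ordinal ltiN)) //=.
rewrite [in RHS](bigD1 (Ordinal ltiN)) //=.
rewrite (eq_bigr (fun k : 'I_N => b k * rfall i%:R k)) => [|k neki].
  by move/addIr/mulIf; apply; apply: rfall_neq0.
have [ltki | ltik | eqki] := ltngtP k i; first by rewrite IH.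
  by rewrite rfall_gt // !mulr0.
by case/eqP: neki; apply: val_inj.
Qed.

Lemma degenerate_stirling2_unique (R : realType) (mu : R)
    (S : nat -> nat -> R) (n k : nat) :
  degenerate_stirling2_spec mu S -> S n k = degenerate_stirling2 mu n k.
Proof.
move=> [S1 S0]; have [T1 T0] := degenerate_stirling2P mu.
have [lekn | ltnk] := leqP k n; last by rewrite S0 // T0.
by apply: (@rfall_free _ n.+1 (S n)) => // x; rewrite -S1 -T1.
Qed.

Lemma degenerate_whitney2_unique (R : realType) (m : nat) (r lambda : R)
    (W : nat -> nat -> R) (n k : nat) :
  (0 < m)%N -> degenerate_whitney2_spec m r lambda W ->
  W n k = degenerate_whitney2 m r lambda n k.
Proof.
move=> m_gt0 [W1 W0]; have [T1 T0] := degenerate_whitney2P m r lambda.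
have [lekn | ltnk] := leqP k n; last by rewrite W0 // T0.
have mk_neq0 : (m%:R : R) ^+ k != 0 by rewrite expf_neq0 // pnatr_eq0 -lt0n.
apply: (mulIf mk_neq0).
apply: (@rfall_free _ n.+1 (fun k => W n k * m%:R ^+ k)
  (fun k => degenerate_whitney2 m r lambda n k * m%:R ^+ k)) => // x.
by rewrite -W1 -T1.
Qed.

(* Main.v *)
(** Splitting [m x + r] as [(r - 1) + (1 + m x)] and applying the Vandermonde
    identity for degenerate falling factorials twice, followed by
    [(m x)_{l,lambda} = m ^ l (x)_{l,lambda/m}], expresses [(m x + r)_{n,lambda}]
    in the basis [(x)_j]; the coefficients are identified by uniqueness. *)
Require Import Defs.
From mathcomp Require Import all_boot all_order all_algebra.
From mathcomp Require Import reals.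

Set Implicit Arguments.
Unset Strict Implicit.
Unset Printing Implicit Defensive.

Import Order.TTheory GRing.Theory Num.Theory.
Local Open Scope ring_scope.

Lemma dfallS (R : realType) (x mu : R) (n : nat) :
  dfall x mu n.+1 = dfall x mu n * (x - n%:R * mu).
Proof. by rewrite /dfall big_ord_recr. Qed.

(** Induction on [n]: in the [k]-th term, the new factor [x + y - n%:R * mu] splits as
    [(x - (n - k)%:R * mu) + (y - k%:R * mu)], and each summand extends one of the two products. *)
Lemma dfallD (R : realType) (x y mu : R) (n : nat) :
  dfall (x + y) mu n
  = \sum_(k < n.+1) 'C(n, k)%:R * dfall x mu (n - k) * dfall y mu k.
Proof.
elim: n => [|n IH]; first by rewrite big_ord1 /dfall !big_ord0 !mulr1.
have -> : dfall (x + y) mu n.+1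
    = \sum_(k < n.+1) 'C(n, k)%:R * dfall x mu (n - k).+1 * dfall y mu k
    + \sum_(k < n.+1) 'C(n, k)%:R * dfall x mu (n - k) * dfall y mu k.+1.
  rewrite dfallS IH mulr_suml -big_split; apply: eq_bigr => k _ /=.
  have -> : x + y - n%:R * mu = (x - (n - k)%:R * mu) + (y - k%:R * mu).
    by rewrite addrACA -opprD -mulrDl -natrD subnK // -ltnS.
  by rewrite !dfallS mulrDr !mulrA; congr (_ + _); rewrite mulrAC.
rewrite [RHS]big_ord_recl /= bin0 subn0.
(* By Pascal's rule, the ['C(n, k)] half is the second sum; the ['C(n, k.+1)] half and the split-off
   term form the first, as ['C(n, n.+1) = 0]. *)
under [X in _ = _ + X]eq_bigr => k _
  do rewrite /bump /= add1n binS subSS natrD !mulrDl.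
rewrite big_split addrA; congr (_ + _).
rewrite big_ord_recl /= bin0 subn0 [in RHS]big_ord_recr /= bin_small // !mul0r.
rewrite addr0; congr (_ + _); apply: eq_bigr => k _.
by rewrite /bump /= add1n subnSK.
Qed.

Lemma dfallM (R : realType) (c x mu : R) (n : nat) :
  c != 0 -> dfall (c * x) mu n = c ^+ n * dfall x (mu / c) n.
Proof.
move=> c_neq0; elim: n => [|n IH]; first by rewrite /dfall !big_ord0 mulr1.
rewrite !dfallS IH exprSr -!mulrA; congr (_ * _); rewrite mulrCA; congr (_ * _).
by rewrite mulrBr [c * (_ * _)]mulrCA [c * (_ / c)]mulrC divfK.
Qed.

(** Padding with zero coefficients gives expansions of different degrees [l] one common index
    range. *)
Lemma dfall_stirling2 (R : realType) (x mu : R) (l N : nat) : (l < N)%N ->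
  dfall x mu l = \sum_(j < N) degenerate_stirling2 mu l j * rfall x j.
Proof.
have [Ssum S0] := degenerate_stirling2P mu.
move=> ltlN; rewrite Ssum (big_ord_widen N (fun j =>
  degenerate_stirling2 mu l j * rfall x j)) // big_mkcond /=.
by apply: eq_bigr => j _; case: ltnP => // ltlj; rewrite S0 // mul0r.
Qed.

Theorem theorem7 (R : realType) (m : nat) (r lambda : R)
    (hm : (0 < m)%N) (hr : 0 <= r) (hlambda : lambda != 0) (n j : nat) :
  degenerate_whitney2 m r lambda n j =
  \sum_(j <= k < n.+1) \sum_(j <= l < k.+1)
    'C(n, k)%:R * 'C(k, l)%:R * dfall (r - 1) lambda (n - k)
    * dfall 1 lambda (k - l) * m%:R ^+ (l - j)
    * degenerate_stirling2 (lambda / m%:R) l j.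
Proof.
set S := degenerate_stirling2 _.
have S0 l i : (l < i)%N -> S l i = 0.
  by have [_ /(_ l i)] := degenerate_stirling2P (lambda / m%:R).
pose c n k l : R :=
  'C(n, k)%:R * 'C(k, l)%:R * dfall (r - 1) lambda (n - k)
  * dfall 1 lambda (k - l).
pose W n j := \sum_(j <= k < n.+1) \sum_(j <= l < k.+1)
  c n k l * m%:R ^+ (l - j) * S l j.
suff Wspec : degenerate_whitney2_spec m r lambda W.
  by rewrite -(degenerate_whitney2_unique n j hm Wspec).
split=> {n j} [n x | n j ltnj]; last by rewrite /W big_geq.
(* The factor [m%:R ^+ j] turns [m ^ (l - j)] into [m ^ l], and both sums may start at 0 because
   [S l j = 0] for [l < j]; the ranges then no longer depend on [j], so the sums can be
   exchanged. *)
have Wm j : W n j * m%:R ^+ j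
    = \sum_(k < n.+1) \sum_(l < k.+1) c n k l * m%:R ^+ l * S l j.
  rewrite /W big_geq_mkord big_mkcond /= mulr_suml; apply: eq_bigr => k _.
  case: leqP => [_ | ltkj].
    rewrite big_geq_mkord big_mkcond /= mulr_suml; apply: eq_bigr => l _.
    case: leqP => [lejl | ltlj]; last by rewrite S0 // mul0r mulr0.
    by rewrite -mulrA [S _ _ * _]mulrC mulrA -[_ * _ * m%:R ^+ j]mulrA -exprD subnK.
  rewrite mul0r big1 // => l _.
  by rewrite S0 ?mulr0 // (leq_ltn_trans _ ltkj) // -ltnS.
under eq_bigr => j _ do rewrite Wm mulr_suml.
rewrite exchange_big /=.
have -> : m%:R * x + r = (r - 1) + (1 + m%:R * x) by rewrite addrA subrK addrC.
rewrite dfallD; apply: eq_bigr => k _.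
under [RHS]eq_bigr => j _ do rewrite mulr_suml.
(* The explicit [1] selects [1 + m%:R * x]; [r - 1] is a sum too. *)
rewrite exchange_big (dfallD 1) mulr_sumr; apply: eq_bigr => l _ /=.
rewrite dfallM ?pnatr_eq0 -?lt0n // (@dfall_stirling2 _ x _ _ n.+1).
  rewrite !mulr_sumr; apply: eq_bigr => i _; rewrite /c !mulrA.
  by congr (_ * _ * _ * _ * _); rewrite mulrAC.
exact: leq_trans (ltn_ord l) (ltn_ord k).
Qed.
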